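(* The constrained minimization $$\arg\min_{\mathbf{x}\in\{0,1\}^{mn^2}}\ \mathbf{x}^\top\mathbf{Q}'\mathbf{x}\quad\text{s.t.}\quad\mathbf{A}\mathbf{x}=\mathbf{b}$$ can be turned into an (unconstrained) quadratic unconstrained binary optimization problem (QUBO) $$\arg\min_{\mathbf{x}\in\{0,1\}^{mn^2}}\ \mathbf{x}^\top\mathbf{Q}\mathbf{x}+\mathbf{s}^\top\mathbf{x},$$ where $\mathbf{Q}=\mathbf{Q}'+\lambda\mathbf{A}^\top\mathbf{A}$ and $\mathbf{s}=-2\lambda\mathbf{A}^\top\mathbf{b}$. Here $\lambda$ is the regularization coefficient, and $\mathbf{Q}'$, $\mathbf{A}$, $\mathbf{b}$ are as defined in the context.
   Context: There are $m$ views with $n$ points each, and $\mathbf{P}_{ij}$ denotes the given (possibly noisy) $n\times n$ relative permutation matrix between views $i$ and $j$. $\mathbf{Q}'$ is the $m\times m$ block matrix whose $(i,j)$ block is $-\mathbf{I}\otimes\mathbf{P}_{ij}$, where $\mathbf{I}$ is the $n\times n$ identity and $\otimes$ is the Kronecker product, so $\mathbf{Q}'$ has size $mn^2\times mn^2$. A vector $\mathbf{x}\in\{0,1\}^{mn^2}$ is the concatenation of $\mathbf{x}_1,\dots,\mathbf{x}_m\in\{0,1\}^{n^2}$, where $\mathbf{x}_i=\mathrm{vec}(\mathbf{X}_i)$ is the vectorization of an $n\times n$ binary matrix $\mathbf{X}_i$ (the unknown absolute permutation of view $i$). The requirement that the rows and columns of $\mathbf{X}_i$ sum to one, i.e. that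 $\mathbf{X}_i$ be a permutation matrix, is written $\mathbf{A}_i\mathbf{x}_i=\mathbf{b}_i$ with $\mathbf{b}_i=\mathbf{1}$ (all-ones vector of length $2n$) and $$\mathbf{A}_i=\begin{bmatrix}\mathbf{I}\otimes\mathbf{1}_n^\top\\ \mathbf{1}_n^\top\otimes\mathbf{I}\end{bmatrix},$$ $\mathbf{1}_n$ being the all-ones vector of length $n$. The matrix $\mathbf{A}=\mathrm{diag}(\mathbf{A}_1,\dots,\mathbf{A}_m)$ is block-diagonal of size $2nm\times mn^2$, and $\mathbf{b}$ is the all-ones vector of length $2nm$, so that $\mathbf{A}\mathbf{x}=\mathbf{b}$ collects the constraints for all views. The coefficient $\lambda$ balances the data term $\mathbf{x}^\top\mathbf{Q}'\mathbf{x}$ against the permutation penalty. *)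

(* Defs.v *)
(* [A *t B] is the Kronecker product. *)
From mathcomp Require Import all_boot all_order all_algebra.
From mathcomp Require Import mxtens.

Set Implicit Arguments.
Unset Strict Implicit.
Unset Printing Implicit Defensive.

Import Order.TTheory GRing.Theory Num.Theory.
Local Open Scope ring_scope.

(* Block-structured vectors and matrices use the index types of [\mxblock]:
   \sum_(i < m) n * n stands for m n^2, and
   \sum_(i < m) (n * 1 + 1 * n) for 2 n m. *)

Definition data_mx (R : pzRingType) (m n : nat) (P : 'I_m -> 'I_m -> 'M[R]_n) :
    'M[R]_(\sum_(i < m) n * n) :=
  \mxblock_(i < m, j < m) (- ((1%:M : 'M[R]_n) *t P i j)).

(* The row index of [A *t B] is i * (number of rows of B) + k, so with the
   column-stacking vec, the first block of [view_constr_mx] applied to vec X gives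
   the column sums of X and the second block gives its row sums. *)
Definition view_constr_mx (R : pzRingType) (n : nat) :
    'M[R]_(n * 1 + 1 * n, n * n) :=
  col_mx ((1%:M : 'M[R]_n) *t (const_mx 1 : 'rV[R]_n))
         ((const_mx 1 : 'rV[R]_n) *t (1%:M : 'M[R]_n)).

(* [\mxdiag] only accepts square blocks. *)
Definition constr_mx (R : pzRingType) (m n : nat) :
    'M[R]_(\sum_(i < m) (n * 1 + 1 * n), \sum_(i < m) n * n) :=
  \mxblock_(i < m, j < m) (if i == j then view_constr_mx R n else 0).

Definition constr_rhs (R : pzRingType) (m n : nat) :
    'cV[R]_(\sum_(i < m) (n * 1 + 1 * n)) :=
  const_mx 1.

Definition binary (R : pzRingType) (N : nat) (x : 'cV[R]_N) : Prop :=
  forall k, x k 0 = 0 \/ x k 0 = 1.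

Definition dotv (R : pzRingType) (N : nat) (u v : 'cV[R]_N) : R :=
  (u^T *m v) 0 0.

Definition quadf (R : pzRingType) (N : nat) (M : 'M[R]_N) (x : 'cV[R]_N) : R :=
  (x^T *m M *m x) 0 0.

Definition argmin (R : realFieldType) (T : Type) (D : T -> Prop) (f : T -> R)
    (x : T) : Prop :=
  D x /\ forall y, D y -> f x <= f y.

Definition qubo_mx (R : pzRingType) (m n : nat) (P : 'I_m -> 'I_m -> 'M[R]_n)
    (lam : R) : 'M[R]_(\sum_(i < m) n * n) :=
  data_mx P + lam *: ((constr_mx R m n)^T *m constr_mx R m n).

Definition qubo_vec (R : pzRingType) (m n : nat) (lam : R) :
    'cV[R]_(\sum_(i < m) n * n) :=
  - (2 * lam) *: ((constr_mx R m n)^T *m constr_rhs R m n).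

(* Main.v *)
(* Expanding |A x - b|^2 shows that the QUBO objective is the penalized objective
   x^T Q' x + lam |A x - b|^2 up to the constant lam |b|^2. On binary x the vector
   A x has natural number entries, so an infeasible x pays a penalty of at least
   lam, while x^T Q' x varies by at most twice the sum B of the absolute values of
   the entries of Q'. As feasible points exist (all views equal to the identity),
   any lam > 2 B makes the penalty exact. *)
Require Import Defs.
From mathcomp Require Import all_boot all_order all_algebra.
From mathcomp Require Import mxtens.
From mathcomp Require Import lra.

Import Order.TTheory GRing.Theory Num.Theory.
Local Open Scope ring_scope.

Lemma argmin_addr_cst (R : realFieldType) (T : Type) (D : T -> Prop)
    (f g : T -> R) (c : R) (x : T) :
  (forall y, f y = g y + c) -> argmin D f x <-> argmin D g x.
Proof.
move=> fE; split=> -[Dx xmin]; split=> // y /xmin;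
  by rewrite !fE lerD2r.
Qed.

Lemma argmin_exact_penalty (R : realFieldType) (T : Type) (D : T -> Prop)
    (C : T -> bool) (f g : T -> R) (B lam : R) (x0 : T) :
    D x0 -> C x0 ->
    (forall y, D y -> `|f y| <= B) ->
    (forall y, C y -> g y = 0) ->
    (forall y, D y -> ~~ C y -> 1 <= g y) ->
    2 * B < lam -> forall x,
  argmin D (fun y => f y + lam * g y) x <-> argmin (fun y => D y /\ C y) f x.
Proof.
move=> Dx0 Cx0 fB g0 g1 ltBlam x.
have B_ge0 : 0 <= B by apply: le_trans (fB _ Dx0).
(* The chain is [f z <= B < lam - B <= f y + lam * g y]; [z] need not satisfy [C], so the same bound
   serves both directions. *)
have penalty y z : D y -> D z -> ~~ C y -> f z < f y + lam * g y.
  move=> Dy Dz nCy; have := g1 y Dy nCy.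
  have /ler_normlP[fy1 fy2] := fB y Dy; have /ler_normlP[fz1 fz2] := fB z Dz.
  have lam_ge0 : 0 <= lam by lra.
  by move=> /(ler_wpM2l lam_ge0); lra.
split=> [[Dx xmin]|[[Dx Cx] xmin]].
  (* A minimizer violating [C] would be strictly beaten by [x0], where the penalty vanishes. *)
  have Cx : C x.
    apply: contraT => /(penalty x x0 Dx Dx0); have := xmin _ Dx0.
    by rewrite (g0 x0)// mulr0 addr0 => /le_lt_trans/[apply]; rewrite ltxx.
  split=> // y [Dy Cy]; have := xmin y Dy.
  by rewrite !g0// !mulr0 !addr0.
split=> // y Dy; rewrite (g0 x)// mulr0 addr0.
have [Cy|/(penalty y x Dy Dx)/ltW//] := boolP (C y).
by rewrite g0// mulr0 addr0 xmin.
Qed.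

Lemma dotvE (R : pzRingType) (N : nat) (u v : 'cV[R]_N) :
  dotv u v = \sum_k u k 0 * v k 0.
Proof. by rewrite /dotv mxE; apply: eq_bigr => k _; rewrite mxE. Qed.

Lemma dotvC (R : comPzRingType) (N : nat) (u v : 'cV[R]_N) :
  dotv u v = dotv v u.
Proof. by rewrite !dotvE; apply: eq_bigr => k _; rewrite mulrC. Qed.

Lemma quadf_least_squares (R : realFieldType) (M N : nat) (Q : 'M[R]_N)
    (A : 'M[R]_(M, N)) (b : 'cV[R]_M) (lam : R) (x : 'cV[R]_N) :
  quadf (Q + lam *: (A^T *m A)) x + dotv (- (2 * lam) *: (A^T *m b)) x =
  quadf Q x + lam * dotv (A *m x - b) (A *m x - b) - lam * dotv b b.
Proof.
have -> : quadf (Q + lam *: (A^T *m A)) x =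
          quadf Q x + lam * dotv (A *m x) (A *m x).
  rewrite /quadf /dotv mulmxDr mulmxDl -scalemxAr -scalemxAl trmx_mul !mulmxA.
  by rewrite !mxE.
have -> : dotv (- (2 * lam) *: (A^T *m b)) x = - (2 * lam) * dotv b (A *m x).
  by rewrite /dotv linearZ /= -scalemxAl mxE trmx_mul trmxK mulmxA.
have -> : dotv (A *m x - b) (A *m x - b) =
    dotv (A *m x) (A *m x) - dotv b (A *m x) - (dotv (A *m x) b - dotv b b).
  by rewrite /dotv mulmxBr [(_ - _)^T]linearB /= !mulmxBl !mxE.
(* Symmetry merges the two cross terms, whence the factor 2 in the linear coefficient. *)
rewrite (dotvC _ _ (A *m x) b); lra.
Qed.

Lemma quadf_binary_bound (R : realFieldType) (N : nat) (Q : 'M[R]_N)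
    (x : 'cV[R]_N) :
  binary x -> `|quadf Q x| <= \sum_i \sum_j `|Q i j|.
Proof.
move=> xbin; have x1 k : `|x k 0| <= 1.
  by case: (xbin k) => ->; rewrite ?normr0 ?normr1 ?ler01.
have -> : quadf Q x = \sum_i \sum_j x i 0 * (Q i j * x j 0).
  rewrite /quadf -mulmxA mxE; apply: eq_bigr => i _.
  by rewrite !mxE mulr_sumr.
apply: le_trans (ler_norm_sum _ _ _) _; apply: ler_sum => i _.
apply: le_trans (ler_norm_sum _ _ _) _; apply: ler_sum => j _.
rewrite !normrM -[leRHS]mul1r ler_pM// ?mulr_ge0//.
by rewrite -[leRHS]mulr1 ler_pM.
Qed.

(** Integrality makes the gap uniform: [c = 0] gives exactly 1, and [c >= 2] gives [c - 1 >= 1]. *)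
Lemma sqr_natrB1_ge1 (R : realFieldType) (c : nat) :
  c%:R != 1 :> R -> 1 <= (c%:R - 1 : R) ^+ 2.
Proof.
case: c => [|[|c]]; rewrite ?eqxx// => _; first by rewrite sub0r sqrrN expr1n.
by rewrite -natr1 addrK expr_ge1// ler1n.
Qed.

Lemma mulmx_binary_nat (R : pzRingType) (M N : nat) (A : 'M[R]_(M, N))
    (x : 'cV[R]_N) :
    (forall i j, A i j = 0 \/ A i j = 1) -> binary x ->
  forall i, exists c : nat, (A *m x) i 0 = c%:R.
Proof.
move=> Abin xbin i; rewrite mxE.
elim/big_ind: _ => [|_ _ [c ->] [d ->]|j _]; first by exists 0.
  by exists (c + d)%N; rewrite natrD.
case: (Abin i j) => ->; first by exists 0; rewrite mul0r.
by rewrite mul1r; case: (xbin j) => ->; [exists 0 | exists 1].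
Qed.

Lemma dotv_ge_sqr (R : realFieldType) (N : nat) (u : 'cV[R]_N) (k : 'I_N) :
  u k 0 ^+ 2 <= dotv u u.
Proof.
rewrite dotvE (bigD1 k)//= -expr2 lerDl sumr_ge0// => j _.
by rewrite -expr2 sqr_ge0.
Qed.

(** A single violated constraint suffices: its residual is a natural number other than 1, minus 1,
    and its square is one term of a sum of squares. *)
Lemma infeasible_gap (R : realFieldType) (M N : nat) (A : 'M[R]_(M, N))
    (x : 'cV[R]_N) :
    (forall i j, A i j = 0 \/ A i j = 1) -> binary x ->
    A *m x != const_mx 1 ->
  1 <= dotv (A *m x - const_mx 1) (A *m x - const_mx 1).
Proof.
move=> Abin xbin Axb.
have [k Axk] : exists k, (A *m x) k 0 != 1.
  apply/existsP; apply: contraNT Axb => /existsPn Ax1.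
  by apply/eqP/colP => k; rewrite [RHS]mxE; have := Ax1 k; rewrite negbK => /eqP.
apply: le_trans (dotv_ge_sqr _ _ _ k).
have -> : (A *m x - const_mx 1) k 0 = (A *m x) k 0 - 1.
  by move: (A *m x) => y; rewrite !mxE.
have [c Ec] := mulmx_binary_nat _ _ _ A x Abin xbin k.
by move: Axk; rewrite Ec; exact: sqr_natrB1_ge1.
Qed.

Lemma view_constr_mx_01 (R : pzRingType) (n : nat) i j :
  view_constr_mx R n i j = 0 \/ view_constr_mx R n i j = 1.
Proof.
rewrite /view_constr_mx mxE; case: split => k; rewrite !mxE ?mulr1 ?mul1r;
  by case: eqP => _; [right | left].
Qed.

Lemma constr_mx_01 (R : pzRingType) (m n : nat) i j :
  constr_mx R m n i j = 0 \/ constr_mx R m n i j = 1.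
Proof.
rewrite /constr_mx mxE; case: ifP => _; last by left; rewrite mxE.
exact: view_constr_mx_01.
Qed.

Lemma sum_mxtens_index (V : nmodType) (m n : nat) (F : 'I_(m * n) -> V) :
  \sum_k F k = \sum_i \sum_j F (mxtens_index (i, j)).
Proof.
rewrite pair_big /= (reindex (@mxtens_index m n)).
  by apply: eq_bigr => -[].
by exists (@mxtens_unindex m n) => k _; rewrite (mxtens_indexK, mxtens_unindexK).
Qed.

(** This is vec of the identity matrix; by symmetry, row and column stacking agree on it. *)
Definition vec1 (R : pzRingType) (n : nat) : 'cV[R]_(n * n) :=
  \col_k ((mxtens_unindex k).1 == (mxtens_unindex k).2)%:R.

Lemma vec1E (R : pzRingType) (n : nat) (i j : 'I_n) :
  vec1 R n (mxtens_index (i, j)) 0 = (i == j)%:R.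
Proof. by rewrite mxE mxtens_indexK. Qed.

Lemma sum_delta2 (R : pzRingType) (n : nat) (i : 'I_n) :
  \sum_j (i == j)%:R * (i == j)%:R = 1 :> R.
Proof.
rewrite (bigD1 i)//= eqxx mulr1 big1 ?addr0// => j /negPf ji.
by rewrite eq_sym ji mul0r.
Qed.

Lemma view_constr_vec1 (R : pzRingType) (n : nat) :
  view_constr_mx R n *m vec1 R n = const_mx 1.
Proof.
rewrite /view_constr_mx mul_col_mx -col_mx_const.
congr col_mx; apply/colP => k; rewrite [RHS]mxE mxE sum_mxtens_index;
  case: (mxtens_indexP k) => i j.
(* Row [i] of the first block: the Kronecker factor selects [l = i], and the inner sum is a row sum
   of the identity. The 1 on the right is expanded by [sum_delta2] to compare term by term. *)
- transitivity (\sum_l (i == l)%:R * (\sum_h (l == h)%:R) : R).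
    apply: eq_bigr => l _; rewrite mulr_sumr; apply: eq_bigr => h _.
    by rewrite vec1E tensmxE !mxE mulr1.
  rewrite -[RHS](sum_delta2 R n i); apply: eq_bigr => l _.
  have [<-|] := eqVneq i l; last by rewrite !mul0r.
  by rewrite (bigD1 i)//= eqxx big1 ?addr0// => h /negPf; rewrite eq_sym => ->.
(* In the second block the Kronecker factor selects [h = j], so [h] becomes the outer index; for
   fixed [h], only [l = h] survives in the inner sum. *)
- rewrite -[RHS](sum_delta2 R n j) exchange_big; apply: eq_bigr => h _.
  rewrite (bigD1 h)//= vec1E tensmxE !mxE eqxx mul1r mulr1 big1 ?addr0.
    by case: eqP; rewrite ?mulr1 ?mulr0.
  by move=> l /negPf lh; rewrite vec1E lh mulr0.
Qed.

Lemma feasible_point (R : pzRingType) (m n : nat) :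
  exists2 x : 'cV[R]_(\sum_(i < m) n * n),
    binary x & constr_mx R m n *m x = constr_rhs R m n.
Proof.
exists (\mxcol_(i < m) vec1 R n).
  by move=> k; rewrite !mxE; case: eqP => _; [right | left].
rewrite /constr_mx mul_mxblock_mxrow /constr_rhs -mxcol_const.
apply: eq_mxcol => i; rewrite (bigD1 i)//= eqxx big1 ?addr0.
  exact: view_constr_vec1.
by move=> j /negPf ji; rewrite eq_sym ji mul0mx.
Qed.

Theorem proposition2 (R : realFieldType) (m n : nat)
    (P : 'I_m -> 'I_m -> 'M[R]_n)
    (P_perm : forall i j : 'I_m, is_perm_mx (P i j)) :
  let A := constr_mx R m n in
  let b := constr_rhs R m n in
  let qubo (lam : R) (x : 'cV[R]_(\sum_(i < m) n * n)) :=
    quadf (qubo_mx P lam) x + dotv (qubo_vec m n lam) x in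
  (forall (lam : R) (x : 'cV[R]_(\sum_(i < m) n * n)),
     argmin (@binary R _) (qubo lam) x <->
     argmin (@binary R _)
       (fun y => quadf (data_mx P) y + lam * dotv (A *m y - b) (A *m y - b)) x)
  /\
  (exists lam0 : R, forall lam : R, lam0 < lam ->
     forall x : 'cV[R]_(\sum_(i < m) n * n),
       argmin (@binary R _) (qubo lam) x <->
       argmin (fun y => binary y /\ A *m y = b) (quadf (data_mx P)) x).
Proof.
move=> A b qubo.
have quboE lam x : argmin (@binary R _) (qubo lam) x <->
    argmin (@binary R _)
      (fun y => quadf (data_mx P) y + lam * dotv (A *m y - b) (A *m y - b)) x.
  (* The additive constant, fixed by unification, is [- (lam * dotv b b)]. *)
  by apply: argmin_addr_cst => y; exact: quadf_least_squares.
split=> //.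
exists (2 * \sum_i \sum_j `|data_mx P i j|) => lam lt_lam x.
have [x0 x0bin Ax0] := feasible_point R m n.
apply: iff_trans (quboE lam x) _.
(* Feasibility enters as a boolean test, since the penalty argument splits on it; the end of the
   proof translates back to the equation. *)
apply: iff_trans
  (argmin_exact_penalty _ _ _ (fun y => A *m y == b) _ _ _ _ x0
     x0bin _ (quadf_binary_bound _ _ _) _ _ lt_lam x) _.
- exact/eqP.
- by move=> y /eqP ->; rewrite subrr /dotv mulmx0 mxE.
- by move=> y ybin; apply: infeasible_gap => //; exact: constr_mx_01.
split=> -[[xbin xC] xmin]; split; try by split=> //; apply/eqP.
  by move=> y [ybin yC]; apply: xmin; split=> //; apply/eqP.
by move=> y [ybin /eqP yC]; exact: xmin.
Qed.
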